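(* Let $X$ be a second countable complex topological vector space, let $(U_n)_{n\geq 1}$ be a countable basis of the topology of $X$, and let $\Gamma$ be a subset of $L(X)$. If $\Gamma$ is codiskcyclic, then $$\mathbb{U}C(\Gamma)=\bigcap_{n\geq1}\left( \bigcup_{\beta\in\mathbb{D}}\bigcup_{T\in \Gamma} T^{-1}(\beta U_{n})\right).$$ As a consequence, $\mathbb{U}C(\Gamma)$ is a $G_\delta$ set.
   Context: $L(X)$ is the set of all continuous linear operators on $X$. Put $\mathbb{U}=\{\alpha\in\mathbb{C} : |\alpha|\geq 1\}$ and $\mathbb{D}=\{\alpha\in\mathbb{C} : |\alpha|\leq 1\}$. For $\Gamma\subset L(X)$ and $x\in X$, the codisk orbit of $x$ under $\Gamma$ is $\mathbb{U}Orb(\Gamma,x)=\{\alpha Tx : \alpha\in\mathbb{U},\ T\in\Gamma\}$. The vector $x$ is a codiskcyclic vector for $\Gamma$ if $\mathbb{U}Orb(\Gamma,x)$ is dense in $X$; the set of all codiskcyclic vectors for $\Gamma$ is denoted $\mathbb{U}C(\Gamma)$, and $\Gamma$ is codiskcyclic if $\mathbb{U}C(\Gamma)\neq\emptyset$. For a set $A\subset X$ and $\beta\in\mathbb{C}$, $\beta A=\{\beta a: a\in A\}$, and $T^{-1}(A)$ is the preimage of $A$ under $T$.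
   Formalization: The union is taken over nonzero β in the disk, since β = 0 would put the zero vector in the right-hand side; and in the displayed formula all basis sets U_n are assumed nonempty, since an empty U_n would make the right-hand side empty. *)

(* Defs.v *)
From HB Require Import structures.
From mathcomp Require Export all_boot all_order all_algebra.
From mathcomp Require Export complex.
From mathcomp Require Export boolp classical_sets functions cardinality reals.
From mathcomp Require Export topology tvs borel_hierarchy.
Set Implicit Arguments.
Unset Strict Implicit.
Unset Printing Implicit Defensive.
Import Order.TTheory GRing.Theory Num.Theory.
Local Open Scope classical_set_scope.
Local Open Scope ring_scope.

Section Codiskcyclic.
Variable R : realType.

(* The order on R[i] is the partial one: z <= w means that w - z is a
   nonnegative real.  As `|a| : R[i] is a nonnegative real, the comparisons
   with 1 below are the usual comparisons of real numbers. *)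
Definition codisk : set R[i] := [set a | 1 <= `|a|].
Definition disk : set R[i] := [set a | `|a| <= 1].

(* topologicalLmodType R[i]: addition, opposite and scalar multiplication are
   (jointly) continuous, R[i] carrying the topology of its modulus; neither
   separation nor local convexity is assumed. *)
Variable X : topologicalLmodType R[i].

Definition cont_linear_ops : set {linear X -> X} :=
  [set T : {linear X -> X} | continuous (T : X -> X)].

Definition scale_set (b : R[i]) (A : set X) : set X := [set b *: x | x in A].

Implicit Type Gamma : set {linear X -> X}.

Definition codisk_orbit Gamma (x : X) : set X :=
  [set y | exists a (T : {linear X -> X}),
     [/\ codisk a, Gamma T & y = a *: T x]].

Definition codiskcyclic_vectors Gamma : set X :=
  [set x | dense (codisk_orbit Gamma x)].

Definition codiskcyclic Gamma : Prop := codiskcyclic_vectors Gamma !=set0.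

End Codiskcyclic.

Arguments codisk {R}.
Arguments disk {R}.
Arguments cont_linear_ops {R} X _.

(* Main.v *)
Require Import Defs.
Import Order.TTheory GRing.Theory Num.Theory.
Local Open Scope classical_set_scope.
Local Open Scope ring_scope.

(** Density of a set can be tested on the nonempty members of a basis, so [x]
    is a codiskcyclic vector exactly when its codisk orbit meets every nonempty
    [U n].  Since inversion exchanges the codisk and the punctured disk,
    [a *: T x] lies in [U n] with [1 <= `|a|] iff [T x] lies in
    [scale_set a^-1 (U n)], where [a^-1] has modulus at most 1 and is nonzero.
    Hence the set of points whose orbit meets [U n] is the double union of the
    formula ([codisk_orbit_meetE]).  That set is also a union of preimages of
    the open set [U n] under the continuous maps [x |-> a *: T x], hence open
    ([open_codisk_orbit_meet]); intersecting over [n] gives both the formula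
    and the G-delta property. *)

Lemma dense_basisP (X : topologicalType) (B : set (set X)) (S : set X) :
  basis B -> dense S <-> forall V, B V -> V !=set0 -> V `&` S !=set0.
Proof.
move=> [Bopen Bnbhs]; split=> [dS V BV V0|SB O [x Ox] oO].
  by apply: dS => //; exact: Bopen.
have [V [BV Vx] VO] := Bnbhs x O (open_nbhs_nbhs (conj oO Ox)).
have [y [Vy Sy]] := SB V BV (ex_intro _ x Vx).
by exists y; split=> //; exact: VO.
Qed.

Lemma continuous_scale_fixed (K : numDomainType) (X : topologicalLmodType K)
    (a : K) : continuous (fun x : X => a *: x).
Proof.
move=> x; apply: (@continuous2_cvg _ _ _ _ _ _ (fun=> a : K^o) id
  (fun (b : K^o) (y : X) => b *: y) a x).
- exact: (scale_continuous (a, x)).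
- exact: cvg_cst.
- exact: cvg_id.
Qed.

Section CodiskOrbit.
Variables (R : realType) (X : topologicalLmodType R[i]).
Implicit Types (Gamma : set {linear X -> X}) (V : set X).

Lemma codisk_neq0 (a : R[i]) : codisk a -> a != 0.
Proof. by rewrite -normr_gt0; exact: lt_le_trans. Qed.

Lemma disk_codiskV (a : R[i]) : codisk a -> (disk `\ 0) a^-1.
Proof.
move=> a1; have a0 := codisk_neq0 _ a1; split; last first.
  by apply/eqP; rewrite invr_eq0.
by rewrite /disk /= normfV invf_le1 ?normr_gt0.
Qed.

Lemma codisk_diskV (b : R[i]) : (disk `\ 0) b -> codisk b^-1.
Proof.
by move=> [b1 /eqP b0]; rewrite /codisk /= normfV invf_ge1 ?normr_gt0.
Qed.

Lemma codisk_orbit_meetE Gamma V :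
  [set x | V `&` codisk_orbit Gamma x !=set0] =
  \bigcup_(b in disk `\ 0) \bigcup_(T in Gamma)
     ((T : X -> X) @^-1` scale_set b V).
Proof.
apply/seteqP; split=> x.
  move=> [y [Vy [a [T [a1 GT yE]]]]].
  exists a^-1; first exact: disk_codiskV.
  by exists T => //; exists y => //; rewrite yE scalerK ?codisk_neq0.
move=> [b bD [T GT [v Vv bvE]]]; exists v; split=> //.
exists b^-1, T; split=> //; first exact: codisk_diskV.
by rewrite -bvE scalerK //; case: bD => _ /eqP.
Qed.

(** Keeping the scalar with [T], instead of dividing [V] by it, exhibits the
    set as a union of preimages of [V] itself under continuous maps. *)
Lemma open_codisk_orbit_meet Gamma V :
  Gamma `<=` cont_linear_ops X -> open V ->
  open [set x | V `&` codisk_orbit Gamma x !=set0].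
Proof.
move=> cGamma oV.
have -> : [set x | V `&` codisk_orbit Gamma x !=set0] =
    \bigcup_(a in codisk) \bigcup_(T in Gamma) [set x | V (a *: T x)].
  apply/seteqP; split=> x.
    move=> [y [Vy [a [T [a1 GT yE]]]]].
    by exists a => //; exists T => //=; rewrite -yE.
  by move=> [a a1 [T GT VaTx]]; exists (a *: T x); split=> //; exists a, T.
apply: bigcup_open => a _; apply: bigcup_open => T /cGamma cT.
have /continuousP : continuous ((fun y : X => a *: y) \o T).
  by move=> x; apply: continuous_comp; [exact: cT|exact: continuous_scale_fixed].
exact.
Qed.

(** A basis is allowed to contain the empty set, which no orbit meets: the
    indices of empty members have to be left out of the intersection. *)
Lemma codiskcyclic_vectors_basisE (U : nat -> set X) Gamma :
  basis (range U) ->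
  codiskcyclic_vectors Gamma =
  \bigcap_(n in [set n | U n !=set0])
     [set x | U n `&` codisk_orbit Gamma x !=set0].
Proof.
move=> bU; apply/seteqP; split=> x.
  by move=> /(dense_basisP _ _ _ bU) xU n Un0; apply: xU => //; exists n.
by move=> xU; apply/(dense_basisP _ _ _ bU) => _ [n _ <-] Un0; exact: xU.
Qed.

End CodiskOrbit.

(* The disk is punctured: for b = 0 the preimage of b U_n = {0} contains 0,
   which is not a codiskcyclic vector unless X has the trivial topology. *)
Theorem proposition2p9 (R : realType) (X : topologicalLmodType R[i])
    (hX : @second_countable X)
    (U : nat -> set X) (hU : basis (range U))
    (Gamma : set {linear X -> X}) (hGamma : Gamma `<=` cont_linear_ops X)
    (hcyc : codiskcyclic Gamma) :
  ((forall n, U n !=set0) ->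
     codiskcyclic_vectors Gamma =
     \bigcap_n \bigcup_(b in disk `\ 0) \bigcup_(T in Gamma)
        ((T : X -> X) @^-1` scale_set b (U n))) /\
  Gdelta (codiskcyclic_vectors Gamma).
Proof.
rewrite (codiskcyclic_vectors_basisE _ _ _ _ hU); split=> [U0|].
  have -> : [set n | U n !=set0] = setT.
    by apply/seteqP; split=> // n _; exact: U0.
  by apply: eq_bigcapr => n _; exact: codisk_orbit_meetE.
(* Gdelta wants a family over all of nat: the indices with U n empty
   contribute the whole space. *)
rewrite bigcap_mkcond; eexists; last by [].
move=> n /=; case: ifP => _; last exact: openT.
by apply: open_codisk_orbit_meet => //; apply: hU.1; exists n.
Qed.
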